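(* Let $\Delta\ge1$ be an integer and let $G=(V,E)$ be an $n$-vertex, unweighted, possibly directed graph whose edges are colored so that every color class has at most $\Delta$ edges. For every set of pairs $P\subseteq V\times V$ there is a $1$-CFT $P$-distance preserver $H\subseteq G$ with \[ |E(H)| = O\Big(n^{2-\frac{2}{2\Delta+3}} \cdot |P|^{\frac{1}{2\Delta+3}} \cdot \Delta \log n\Big). \]
   Context: An edge-colored graph assigns each edge exactly one color, with no restrictions; a color class is the set of edges of one color. For a color $c$, $G-c$ denotes $G$ with all edges of color $c$ deleted. A subgraph $H\subseteq G$ is a $1$-CFT $P$-distance preserver if for every color $c$ and every $(s,t)\in P$, the distance from $s$ to $t$ in $H-c$ equals the distance from $s$ to $t$ in $G-c$. *)

(* Defs.v *)
From HB Require Import structures.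
From mathcomp Require Import all_boot all_order all_algebra.
From mathcomp Require Import boolp reals exp.

Set Implicit Arguments.
Unset Strict Implicit.
Unset Printing Implicit Defensive.

Variant orientation := Directed | Undirected.

(* Potential edges: ordered pairs or unordered pairs, without loops. *)
Definition edge (o : orientation) (V : finType) : finType :=
  match o with
  | Directed => (V * V)%type
  | Undirected => {set V}
  end.

Definition is_edge (o : orientation) (V : finType) : pred (edge o V) :=
  match o return pred (edge o V) with
  | Directed => fun e => e.1 != e.2
  | Undirected => fun e => #|e| == 2
  end.

(* [joins e x y]: the edge [e] can be traversed from [x] to [y]. *)
Definition joins (o : orientation) (V : finType) : edge o V -> rel V :=
  match o return edge o V -> rel V with
  | Directed => fun e x y => e == (x, y)
  | Undirected => fun e x y => e == [set x; y]
  end.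

(* Only the values of [color] on [edges] are meaningful. *)
Record colored_graph (o : orientation) (V : finType) (K : eqType) :=
  ColoredGraph {
    edges : {set edge o V};
    edgesP : forall e, e \in edges -> is_edge e;
    color : edge o V -> K
  }.

Definition adj (o : orientation) (V : finType) (F : {set edge o V}) : rel V :=
  fun x y => [exists e in F, joins e x y].

Definition walk (V : finType) (r : rel V) (x y : V) (k : nat) : bool :=
  [exists p : k.-tuple V, path r x p && (last x p == y)].

(* [None] stands for an infinite distance (no walk from [x] to [y]). *)
Definition dist (V : finType) (r : rel V) (x y : V) : option nat :=
  match pselect (exists k, walk r x y k) with
  | left ex_walk => Some (ex_minn ex_walk)
  | right _ => None
  end.

Section ColorFaults.
Variables (o : orientation) (V : finType) (K : eqType).
Variable G : colored_graph o V K.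

Definition color_class (c : K) : {set edge o V} :=
  [set e in edges G | color G e == c].

Definition delete_color (F : {set edge o V}) (c : K) : {set edge o V} :=
  [set e in F | color G e != c].

(* A subgraph is given by its edge set; its vertex set is all of [V] and it
   inherits the coloring of [G]. *)
Definition cft1_preserver (P : {set V * V}) (H : {set edge o V}) : Prop :=
  H \subset edges G /\
  forall (c : K) (s t : V), (s, t) \in P ->
    dist (adj (delete_color H c)) s t =
    dist (adj (delete_color (edges G) c)) s t.

End ColorFaults.

(* Main.v *)
Require Import Defs.
From HB Require Import structures.
From mathcomp Require Import all_boot all_order all_algebra.
From mathcomp Require Import boolp reals sequences exp.
From mathcomp Require Import zify ring lra.

(* Let [lam] be about (n^2 / |P|)^(1 / (2 Delta + 3)) and l = lam^(Delta + 1).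

   Replacement paths of length at most l for a pair of P are kept whole: the
   pair needs one shortest path and one replacement path for each color on it,
   at most l + l^2 edges.  Longer replacement paths meet, within distance l of
   their end, a greedy hitting set S of size O((n / l) log n), so it suffices to
   preserve the distances from S in the graph and in its reverse.

   Fix a target t.  The level of an edge is the distance to t of its head, when
   the edge lies on some shortest path to t.  A color has at most Delta edges,
   hence misses one of the Delta + 1 bands of levels [lam^i, lam^(i+1)).  Choose
   hitting sets B_i, containing S, for the last lam^(i+1) vertices of the
   replacement paths.  If c misses band i, then c can only meet the shortest
   path from r in B_i to t, when dist(r, t) <= lam^(i+1), in its last lam^i
   edges.  So 1 + lam^i last edges for each r in B_i are enough, and
   |B_i| lam^i = O((n log n) / lam) for each of the Delta + 1 values of i. *)

Set Implicit Arguments.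
Unset Strict Implicit.
Unset Printing Implicit Defensive.

Import Order.TTheory GRing.Theory Num.Theory.

(** * Walks as edge sequences, geodesics and edge levels *)

Section EdgeWalks.
Variables (V E : finType) (J : E -> rel V).
Implicit Types (x y z : V) (es : seq E) (F : {set E}) (k : nat).

(** Walks list edges rather than vertices because colors sit on edges. With [J] abstract, directed,
    undirected and reversed graphs are treated alike. *)
Fixpoint ewalk x es y : bool :=
  if es is e :: es' then [exists z, J e x z && ewalk z es' y] else x == y.

Definition reach F k x y : Prop :=
  exists es, [/\ size es = k, {subset es <= F} & ewalk x es y].

(** The distance as a relation, which simply fails for unreachable pairs. *)
Definition geodesic F k x y : Prop :=
  reach F k x y /\ forall j, reach F j x y -> k <= j.

Lemma ewalk_cat x es1 es2 y :
  reflect (exists2 z, ewalk x es1 z & ewalk z es2 y) (ewalk x (es1 ++ es2) y).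
Proof.
elim: es1 x => [|e es1 IH] x /=.
  apply: (iffP idP) => [w|[z /eqP-> //]]; by exists x.
apply: (iffP fintype.existsP) => [[z /andP[Jxz /IH[u w1 w2]]]|[u /fintype.existsP[z /andP[Jxz w1]] w2]].
  by exists u => //; apply/fintype.existsP; exists z; rewrite Jxz.
by exists z; rewrite Jxz; apply/IH; exists u.
Qed.

Lemma reach0 F x y : reach F 0 x y <-> x = y.
Proof.
split=> [[es [/size0nil-> _ /eqP]] //|->].
by exists [::]; split=> //=.
Qed.

Lemma reach1 F x y : reach F 1 x y <-> exists2 e, e \in F & J e x y.
Proof.
split=> [[[|e [|? ?]] [] //= _ sF /fintype.existsP[z /andP[Jxz /eqP<-]]]|[e eF Jxy]].
  by exists e; rewrite // sF ?mem_head.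
exists [:: e]; split=> //= [e'|]; first by rewrite inE => /eqP->.
by apply/fintype.existsP; exists y; rewrite Jxy eqxx.
Qed.

Lemma reachD F a b x y :
  reach F (a + b) x y <-> exists2 z, reach F a x z & reach F b z y.
Proof.
split=> [[es [sz sF]]|[z [es1 [sz1 sF1 w1]] [es2 [sz2 sF2 w2]]]].
  rewrite -(cat_take_drop a es) => /ewalk_cat[z w1 w2]; exists z.
    exists (take a es); split=> // [|e /mem_take /sF //].
    by rewrite size_take; case: ifP; lia.
  exists (drop a es); split=> // [|e /mem_drop /sF //].
  by rewrite size_drop; lia.
exists (es1 ++ es2); split.
- by rewrite size_cat sz1 sz2.
- by move=> e; rewrite mem_cat => /orP[/sF1|/sF2].
- by apply/ewalk_cat; exists z.
Qed.

Lemma sub_reach F F' k x y : F \subset F' -> reach F k x y -> reach F' k x y.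
Proof.
move=> /subsetP sFF [es [sz sF w]]; exists es; split=> // e /sF; exact: sFF.
Qed.

Lemma reach_geodesic F k x y :
  reach F k x y -> exists2 m, geodesic F m x y & m <= k.
Proof.
elim/ltn_ind: k => k IH w.
have [[j [jk wj]]|no] := pselect (exists j, j < k /\ reach F j x y).
  by have [m gm mj] := IH j jk wj; exists m => //; lia.
exists k => //; split=> // j wj; rewrite leqNgt; apply/negP => jk.
by apply: no; exists j.
Qed.

(** A shorter replacement for either piece would shorten the whole walk. *)
Lemma geodesic_split F a b x y z :
  geodesic F (a + b) x y -> reach F a x z -> reach F b z y ->
  geodesic F a x z /\ geodesic F b z y.
Proof.
move=> [_ gmin] w1 w2; split; split=> // j wj.
  have /gmin : reach F (j + b) x y by apply/reachD; exists z.
  lia.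
have /gmin : reach F (a + j) x y by apply/reachD; exists z.
lia.
Qed.

Lemma geodesic_uniq F j k x y : geodesic F j x y -> geodesic F k x y -> j = k.
Proof. by move=> [wj mj] [wk mk]; have := mj _ wk; have := mk _ wj; lia. Qed.

Lemma sub_geodesic F F' k x y :
  F \subset F' -> geodesic F' k x y -> reach F k x y -> geodesic F k x y.
Proof. by move=> sF [_ gmin] w; split=> // j /(sub_reach sF)/gmin. Qed.

(* [k] is the level of the end [y] of [e]: an undirected edge descends towards [t]
   in at most one direction, so it too has at most one level. *)
Definition at_level (G : {set E}) t e k : Prop :=
  exists x y, [/\ J e x y, geodesic G k y t & geodesic G k.+1 x t].

Lemma at_level_uniq G t e j k :
  (forall x y x' y', J e x y -> J e x' y' ->
     (x' = x /\ y' = y) \/ (x' = y /\ y' = x)) ->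
  at_level G t e j -> at_level G t e k -> j = k.
Proof.
move=> J2 [x [y [Jxy gy gx]]] [x' [y' [Jxy' gy' gx']]].
case: (J2 _ _ _ _ Jxy Jxy') => -[ex ey]; subst x' y'.
  exact: geodesic_uniq gy gy'.
(* Opposite traversals would force both [j = k.+1] and [k = j.+1]. *)
by have := geodesic_uniq gy gx'; have := geodesic_uniq gx gy'; lia.
Qed.

Lemma geodesic_levels G t m r es e i :
  geodesic G m r t -> size es = m -> {subset es <= G} -> ewalk r es t ->
  e \in take (m - i) es -> exists2 k, at_level G t e k & i <= k < m.
Proof.
move=> gm sz sG w eT.
have [n1 n1lt en1] : exists2 n1, n1 < m - i & nth e es n1 = e.
  have lt1 : index e (take (m - i) es) < m - i.
    move: eT; rewrite -index_mem size_take; case: ifP; lia.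
  exists (index e (take (m - i) es)) => //.
  by rewrite -(nth_take e lt1 es) nth_index.
have n1m : n1 < size es by rewrite sz; lia.
move: (w); rewrite -(cat_take_drop n1 es) (drop_nth e n1m) en1.
move=> /ewalk_cat[x w1 /= /fintype.existsP[y /andP[Jxy w2]]].
have sz1 : size (take n1 es) = n1 by rewrite size_take n1m.
have sz2 : size (drop n1.+1 es) = m - n1.+1 by rewrite size_drop sz.
have sG1 : {subset take n1 es <= G} by move=> a /mem_take /sG.
have sG2 : {subset drop n1.+1 es <= G} by move=> a /mem_drop /sG.
have r1 : reach G n1 r x by exists (take n1 es).
have r2 : reach G (m - n1.+1) y t by exists (drop n1.+1 es).
have eG : e \in G by apply: sG; rewrite -en1 mem_nth.
have rxy : reach G 1 x y by apply/reach1; exists e.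
have rx : reach G (m - n1.+1).+1 x t by rewrite -add1n; apply/reachD; exists y.
have ryr : reach G n1.+1 r y by rewrite -addn1; apply/reachD; exists x.
(* The edge at position [n1], counted from 0, leaves [m - n1.+1] edges after its head; this is at
   least [i] because [n1 < m - i]. *)
exists (m - n1.+1); last lia.
exists x, y; split=> //.
  have gm' : geodesic G (n1.+1 + (m - n1.+1)) r t.
    by rewrite (_ : n1.+1 + _ = m) //; lia.
  by have [] := geodesic_split gm' ryr r2.
have gm' : geodesic G (n1 + (m - n1.+1).+1) r t.
  by rewrite (_ : n1 + _ = m) //; lia.
by have [] := geodesic_split gm' r1 rx.
Qed.

End EdgeWalks.

(** * Reversal of walks *)

Lemma ewalk_rev (V E : finType) (J : E -> rel V) x es y :
  ewalk (fun e a b => J e b a) y (rev es) x = ewalk J x es y.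
Proof.
elim: es x y => [|e es IH] x y /=; first by rewrite eq_sym.
rewrite rev_cons -cats1; apply/ewalk_cat/fintype.existsP => [[z w /=]|[z /andP[Jxz w]]].
  move=> /fintype.existsP[u /andP[Jxz /eqP eu]]; subst u.
  by exists z; rewrite -IH w Jxz.
exists z; first by rewrite IH.
by apply/fintype.existsP; exists x; rewrite Jxz eqxx.
Qed.

Lemma reach_rev (V E : finType) (J : E -> rel V) F k x y :
  reach (fun e a b => J e b a) F k y x <-> reach J F k x y.
Proof.
split=> -[es [sz sF w]]; exists (rev es); split.
- by rewrite size_rev.
- by move=> e; rewrite mem_rev => /sF.
- by rewrite -ewalk_rev revK.
- by rewrite size_rev.
- by move=> e; rewrite mem_rev => /sF.
- by rewrite ewalk_rev.
Qed.

Lemma geodesic_rev (V E : finType) (J : E -> rel V) F k x y :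
  geodesic (fun e a b => J e b a) F k y x <-> geodesic J F k x y.
Proof.
by split=> -[/reach_rev w gm]; split=> // j /reach_rev; exact: gm.
Qed.

(** * Greedy hitting sets *)

Section HittingSets.
Variable T : finType.
Implicit Types (W : {set {set T}}) (A B : {set T}) (L k : nat).

(** Averaging: each set is missed by at most [#|T| - L] points, so the point that misses the fewest
    sets misses at most the fraction [1 - L / #|T|] of them. The inequality is multiplied out to
    stay in [nat]. *)
Lemma greedy_step W L : 0 < #|T| -> (forall A, A \in W -> L <= #|A|) ->
  exists v, #|[set A in W | v \notin A]| * #|T| <= #|W| * (#|T| - L).
Proof.
move=> /card_gt0P[v0 _] big.
pose f v := #|[set A in W | v \notin A]|.
case: (arg_minnP f (isT : predT v0)) => v _ minv; exists v.
have fE u : f u = \sum_(A in W) (u \notin A).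
  by rewrite /f -sum1_card big_mkcond [RHS]big_mkcond; apply: eq_bigr => A _;
     rewrite inE; case: (A \in W); case: (u \in A).
apply: (@leq_trans (\sum_u f u)).
  rewrite mulnC -[#|T|]card_ord -sum_nat_const.
  rewrite sum_nat_const card_ord -sum_nat_const; apply: leq_sum => u _; exact: minv.
under eq_bigr do rewrite fE.
rewrite exchange_big /= -sum_nat_const; apply: leq_sum => A /big LA.
suff -> : \sum_u (u \notin A) = #|~: A| by rewrite cardsCs setCK leq_sub2l.
by rewrite -sum1_card [RHS]big_mkcond; apply: eq_bigr => u _; rewrite inE; case: (u \in A).
Qed.

Lemma greedy_hitting_set W L k :
  0 < #|T| -> (forall A, A \in W -> L <= #|A|) ->
  exists2 B : {set T}, #|B| <= k &
    #|[set A in W | [disjoint A & B]]| * #|T| ^ k <= #|W| * (#|T| - L) ^ k.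
Proof.
move=> T0 big; elim: k => [|k [B Bk IH]].
  exists set0; rewrite ?cards0 // !expn0 !muln1 subset_leq_card //.
  by apply/subsetP => A; rewrite inE => /andP[].
have [|v hv] := @greedy_step [set A in W | [disjoint A & B]] L T0.
  by move=> A; rewrite inE => /andP[/big].
exists (v |: B); first by rewrite cardsU1; case: (v \in B); lia.
have -> : [set A in W | [disjoint A & v |: B]] =
   [set A in [set A in W | [disjoint A & B]] | v \notin A].
  apply/setP=> A; rewrite !inE -andbA; congr andb.
  by rewrite -!setI_eq0 setIUr setU_eq0 andbC [_ :&: [set v]]setIC !setI_eq0 disjoints1.
rewrite !expnS mulnA; apply: leq_trans (leq_mul hv (leqnn _)) _.
by rewrite mulnAC [X in _ <= X]mulnCA mulnC leq_mul2l IH orbT.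
Qed.

Local Open Scope ring_scope.

(** After [k] greedy rounds at most [#|W| * (1 - L / #|T|) ^ k <= #|W| * exp (- k * L / #|T|)] sets
    are unhit. This is below 1, hence zero, once [k] exceeds [y], which is [#|T| / L * ln #|W|]. *)
Lemma small_hitting_set (R : realType) W L :
  (0 < L)%N -> (forall A, A \in W -> (L <= #|A|)%N) ->
  exists2 B : {set T}, (forall A, A \in W -> exists2 v, v \in A & v \in B) &
    #|B|%:R <= #|T|%:R / L%:R * (ln #|W|%:R + 1) :> R.
Proof.
move=> L0 big; have [W0|/set0Pn[A0 A0W]] := eqVneq W set0.
  exists set0; first by move=> A; rewrite W0 inE.
  by rewrite W0 !cards0 ln0 // add0r mulr1 divr_ge0.
have Ln : (L <= #|T|)%N by rewrite (leq_trans (big _ A0W)) // max_card.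
have n0 : (0 < #|T|)%N by lia.
have N0 : (0 < #|W|)%N by rewrite (cardD1 A0) A0W.
have n0R : 0 < #|T|%:R :> R by rewrite ltr0n.
have L0R : 0 < L%:R :> R by rewrite ltr0n.
have LnR : L%:R <= #|T|%:R :> R by rewrite ler_nat.
have lnN : 0 <= ln #|W|%:R :> R by rewrite ln_ge0 // ler1n.
pose y : R := #|T|%:R / L%:R * ln #|W|%:R.
have y0 : 0 <= y by rewrite mulr_ge0 // divr_ge0 // ltW.
have [B Bk hB] := @greedy_hitting_set W L (Num.truncn y).+1 n0 big.
have yk : y < (Num.truncn y).+1%:R by exact: truncnS_gt.
exists B; last first.
  have ty : (Num.truncn y)%:R <= y by rewrite truncn_le.
  (* Rounding [y] up costs at most 1, which is at most [#|T| / L]; this is the summand 1 next to the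
     logarithm. *)
  apply: (@le_trans _ _ (y + 1)).
    by rewrite (le_trans (y := (Num.truncn y).+1%:R)) ?ler_nat // -natr1 lerD2r.
  by rewrite mulrDr mulr1 lerD2l ler_pdivlMr // mul1r.
set k := (Num.truncn y).+1 in yk hB *.
have unhit0 : #|[set A in W | [disjoint A & B]]| = 0%N.
  apply/eqP; rewrite -leqn0 -ltnS -(ltr_nat R).
  have nk0 : 0 < #|T|%:R ^+ k :> R by rewrite exprn_gt0.
  rewrite -(ltr_pM2r nk0).
  apply: (@le_lt_trans _ _ (#|W|%:R * (#|T|%:R - L%:R) ^+ k)).
    by rewrite -natrB // -!natrX -!natrM ler_nat.
  have -> : #|T|%:R - L%:R = #|T|%:R * (1 - L%:R / #|T|%:R) :> R.
    by field; rewrite gt_eqF.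
  rewrite exprMn mulrCA mul1r gtr_pMr //.
  apply: (@le_lt_trans _ _ (#|W|%:R * expR (- (L%:R / #|T|%:R)) ^+ k)).
    rewrite ler_wpM2l // ler_pXn2r ?nnegrE ?expR_ge0 ?expR_ge1Dx //.
    by rewrite subr_ge0 ler_pdivrMr // mul1r.
  rewrite -expRM_natl -[X in X * _]lnK ?posrE ?ltr0n // -expRD expR_lt1.
  by rewrite mulrN subr_lt0 mulrA ltr_pdivlMr // mulrC -ltr_pdivrMr // mulrAC.
move=> A AW; have : A \notin [set A in W | [disjoint A & B]].
  by move/eqP: unhit0; rewrite cards_eq0 => /eqP->; rewrite inE.
by rewrite inE AW /= => /pred0Pn[v /andP[vA vB]]; exists v.
Qed.

End HittingSets.

Lemma card_bigcup_le (I T : finType) (F : I -> {set T}) (A : pred I) :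
  #|\bigcup_(i | A i) F i| <= \sum_(i | A i) #|F i|.
Proof.
elim/big_rec2: _ => [|i m B _ le_m]; first by rewrite cards0.
by apply: leq_trans (leq_card_setU _ _) _; rewrite leq_add2l.
Qed.

(** * Replacement paths under the fault of one color *)

Section ColorFaultWalks.
Variables (V E : finType) (K : eqType) (J : E -> rel V).
Variables (G : {set E}) (col : E -> K).
Implicit Types (c : K) (x y z s t r u : V) (e : E) (d i j k : nat) (F : {set E}).

Definition avoid (F : {set E}) c : {set E} := [set e in F | col e != c].

Lemma avoid_sub F c : avoid F c \subset F.
Proof. by apply/subsetP => e; rewrite inE => /andP[]. Qed.

Lemma avoidS F F' c : F \subset F' -> avoid F c \subset avoid F' c.
Proof.
by move=> /subsetP sF; apply/subsetP => e; rewrite !inE => /andP[/sF-> ->].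
Qed.

(** One witness is stored for each color of [cs] that has any. The predicate [Q] stays abstract
    because the witnesses are whole replacement paths in one use and single last edges in
    another. *)
Lemma collect_witnesses (Q : K -> seq E -> Prop) l (cs : seq K) :
  (forall c es, Q c es -> size es <= l /\ {subset es <= G}) ->
  exists M : seq E, [/\ {subset M <= G}, size M <= size cs * l &
    forall c es, c \in cs -> Q c es ->
      exists2 es', Q c es' & {subset es' <= M}].
Proof.
move=> Qb; elim: cs => [|c cs [M [MG Ml MQ]]]; first by exists [::].
have [[es Qes]|noQ] := pselect (exists es, Q c es).
  have [esl esG] := Qb _ _ Qes.
  exists (es ++ M); split.
  - by move=> e; rewrite mem_cat => /orP[/esG|/MG].
  - by rewrite size_cat /= mulSn leq_add.
  - move=> c' es'; rewrite inE => /orP[/eqP-> _|c's Q'].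
      by exists es => // e ees; rewrite mem_cat ees.
    have [es'' Q'' s''] := MQ _ _ c's Q'.
    by exists es'' => // e /s''; rewrite mem_cat orbC => ->.
exists M; split=> //; first by rewrite mulSn (leq_trans Ml) // leq_addl.
move=> c' es; rewrite inE => /orP[/eqP-> Qc|]; last exact: MQ.
by case: noQ; exists es.
Qed.

(** Fix one shortest path [es0]. A color off [es0] leaves it intact; the at most [l] colors on it
    get one stored replacement path each. *)
Lemma short_replacements s t l :
  exists M : seq E, [/\ {subset M <= G}, size M <= l + l * l &
    forall c d, geodesic J (avoid G c) d s t -> d <= l ->
      exists es, [/\ size es = d, {subset es <= M}, {subset es <= avoid G c} &
                     ewalk J s es t]].
Proof.
(* Deleting a color never shortens distances, so without a path of length at most [l] in [G] nothing
   has to be kept. *)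
have [[m [gm ml]]|no] := pselect (exists m, geodesic J G m s t /\ m <= l); last first.
  exists [::]; split=> // c d [w _] dl; case: no.
  have [m gm md] := reach_geodesic (sub_reach (avoid_sub G c) w).
  by exists m; split=> //; lia.
have [[es0 [sz0 sG0 w0]] min0] := gm.
pose Q c es := [/\ {subset es <= avoid G c}, ewalk J s es t &
  size es <= l /\ geodesic J (avoid G c) (size es) s t].
have [|M [MG Ml MQ]] := @collect_witnesses Q l (map col es0).
  move=> c es [sG _ [-> _]]; split=> // e /sG; exact: (subsetP (avoid_sub G c)).
exists (es0 ++ M); split.
- by move=> e; rewrite mem_cat => /orP[/sG0|/MG].
- rewrite size_cat sz0 leq_add // (leq_trans Ml) // size_map sz0.
  by rewrite leq_mul2r ml orbT.
move=> c d gd dl.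
have [cin|cout] := boolP (c \in map col es0).
  have [[es [sz sG w]] _] := gd.
  have [|es' [sG' w' [l' g']] sM] := MQ c es cin; first by split; rewrite ?sz.
  exists es'; split=> // [|e /sM]; first exact: geodesic_uniq g' gd.
  by rewrite mem_cat orbC => ->.
have sG0' : {subset es0 <= avoid G c}.
  move=> e ee; rewrite inE sG0 //=; apply: contra cout => /eqP <-.
  exact: map_f.
have r0 : reach J (avoid G c) m s t by exists es0.
have g0 := sub_geodesic (avoid_sub G c) gm r0.
exists es0; split=> //; last by move=> e ee; rewrite mem_cat ee.
by rewrite sz0; exact: geodesic_uniq g0 gd.
Qed.

Variables (Delta lam : nat).
Hypothesis J2 : forall e x y x' y', J e x y -> J e x' y' ->
  (x' = x /\ y' = y) \/ (x' = y /\ y' = x).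
Hypothesis class_le : forall c, #|[set e in G | col e == c]| <= Delta.
Hypothesis lam_gt0 : 0 < lam.

Definition free_band c t i : Prop := forall e k,
  e \in G -> col e = c -> at_level J G t e k -> ~~ (lam ^ i <= k < lam ^ i.+1).

(** Pigeonhole: the bands are disjoint and an edge has at most one level, so if [c] met all
    [Delta.+1] bands, it would have [Delta.+1] distinct edges. *)
Lemma exists_free_band c t : exists2 i, i < Delta.+1 & free_band c t i.
Proof.
have [[i [iD fr]]|no] := pselect (exists i, i < Delta.+1 /\ free_band c t i).
  by exists i.
have hit (i : 'I_Delta.+1) : exists e, e \in [set e in G | col e == c] /\
    exists2 k, at_level J G t e k & lam ^ i <= k < lam ^ i.+1.
  apply: contrapT => noe; apply: no; exists i; split=> // e k eG ec lv.
  apply/negP => bk; apply: noe; exists e; split; last by exists k.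
  by rewrite inE eG ec eqxx.
have [f fP] := fin_all_exists hit.
have finj : injective f.
  move=> i j fij; have [_ [k lk bk]] := fP i; have [_ [k' lk' bk']] := fP j.
  rewrite -fij in lk'; have ek := at_level_uniq (J2 (e := f i)) lk lk'; subst k'.
  have [/andP[ge_i lt_i] /andP[ge_j lt_j]] := (bk, bk').
  apply/val_inj/eqP; rewrite eqn_leq; apply/andP.
  split; rewrite leqNgt; apply/negP => /(leq_pexp2l lam_gt0) le.
    by have := leq_ltn_trans (leq_trans le ge_i) lt_j; rewrite ltnn.
  by have := leq_ltn_trans (leq_trans le ge_j) lt_i; rewrite ltnn.
have : #|codom f| <= #|[set e in G | col e == c]|.
  by apply/subset_leq_card/subsetP => _ /codomP[i ->]; have [] := fP i.
rewrite card_codom // card_ord => /leq_trans/(_ (class_le c)); lia.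
Qed.

(** Fix a shortest path from [r] to [t]. Keep its last edge, and one further last edge for each
    color on its final [lam ^ i] edges. Any other color with band [i] free misses the whole path:
    the earlier edges have levels from [lam ^ i] up to below [lam ^ i.+1]. *)
Lemma last_edges r t i :
  exists M : seq E, [/\ {subset M <= G}, size M <= 1 + lam ^ i &
    forall c d, free_band c t i -> geodesic J (avoid G c) d.+1 r t ->
      d.+1 <= lam ^ i.+1 ->
      exists e u, [/\ e \in M, col e != c, J e u t & reach J (avoid G c) d r u]].
Proof.
have [[m gm]|no] := pselect (exists m, geodesic J G m r t); last first.
  exists [::]; split=> // c d _ [w _] _; case: no.
  by have [m gm _] := reach_geodesic (sub_reach (avoid_sub G c) w); exists m.
have [[es [sz sG w]] min0] := gm.
(* When [r = t] no geodesic from [r] to [t] has positive length, so no last edge is needed. *)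
case: m => [|m] in gm sz min0 *.
  exists [::]; split=> // c d _ [_ gmin] _.
  have /gmin // : reach J (avoid G c) 0 r t.
  by move/size0nil: sz w => -> /= /eqP ->; apply/reach0.
case/lastP: es => [//|es e] in sz sG w *; move: sz; rewrite size_rcons => -[sz].
pose Q c es' := exists e' u d, [/\ es' = [:: e'], e' \in avoid G c, J e' u t,
  reach J (avoid G c) d r u & geodesic J (avoid G c) d.+1 r t].
have [|M [MG Ml MQ]] :=
    @collect_witnesses Q 1 (map col (drop (m.+1 - lam ^ i) (rcons es e))).
  move=> c _ [e' [u [d [-> e'G _ _ _]]]]; split=> // e''; rewrite inE => /eqP->.
  exact: (subsetP (avoid_sub G c)).
exists (e :: M); split.
- by move=> e'; rewrite inE => /orP[/eqP->|/MG //]; apply: sG; rewrite mem_rcons mem_head.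
- rewrite /= add1n ltnS (leq_trans Ml) // muln1 size_map size_drop size_rcons sz; lia.
move=> c d fr gd dl.
have [cin|cout] := boolP (c \in map col (drop (m.+1 - lam ^ i) (rcons es e))).
  have [wd _] := gd; move: (wd); rewrite -addn1 => /reachD[u wu /reach1[e' e'G Je']].
  have [|_ [e'' [u'' [d'' [-> e''G Je'' w'' g'']]]] sM] := MQ c [:: e'] cin.
    by exists e', u, d.
  have [dd] : d''.+1 = d.+1 := geodesic_uniq g'' gd; subst d''.
  exists e'', u''; split=> //; first by rewrite inE sM ?orbT ?mem_head.
  by move: e''G; rewrite inE => /andP[].
have md : m.+1 <= d.+1.
  by have [wd _] := gd; apply: min0; exact: sub_reach (avoid_sub G c) wd.
have sGc : {subset rcons es e <= avoid G c}.
  move=> e' e'in; rewrite inE sG //=; apply/eqP => ce'.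
  move: (e'in); rewrite -(cat_take_drop (m.+1 - lam ^ i) (rcons es e)) mem_cat.
  case/orP => [e'T|e'D]; last by move/negP: cout; apply; rewrite -ce' map_f.
  have szr : size (rcons es e) = m.+1 by rewrite size_rcons sz.
  have [k lk bk] := geodesic_levels gm szr sG w e'T.
  move/andP: bk => [ge_k lt_k]; move/negP: (fr _ _ (sG _ e'in) ce' lk); apply.
  by rewrite ge_k (leq_trans lt_k) // (leq_trans md).
have rm : reach J (avoid G c) m.+1 r t.
  by exists (rcons es e); rewrite size_rcons sz.
(* The path survives the fault, so its length is also the distance after it. *)
have [dm] : m.+1 = d.+1 by have [_ /(_ _ rm)] := gd; lia.
move: w; rewrite -cats1 => /ewalk_cat[u w1 /= /fintype.existsP[y /andP[Juy /eqP yt]]].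
subst y; exists e, u; split=> //.
- exact: mem_head.
- have /sGc : e \in rcons es e by rewrite mem_rcons mem_head.
  by rewrite inE => /andP[].
- by exists es; split; rewrite ?sz ?dm=> // e' e'in; apply: sGc; rewrite mem_rcons inE e'in orbT.
Qed.

(** The vertex [r] lies on some shortest path, not on a prescribed one; [0 < j] keeps it away from
    [t], so that a last edge from [r] to [t] exists. *)
Definition hits_suffixes (B : {set V}) L : Prop :=
  forall c s t d, geodesic J (avoid G c) d s t -> L <= d ->
    exists r j, [/\ r \in B, 0 < j <= L, j <= d,
      reach J (avoid G c) (d - j) s r & reach J (avoid G c) j r t].

(* A last edge suffices at each target: the rest of the path is a replacement
   path from the same source to a nearer target. *)
Lemma sourcewise_preserver (S : {set V}) (B : nat -> {set V}) :
  (forall i, S \subset B i) -> (forall i, hits_suffixes (B i) (lam ^ i.+1)) ->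
  exists H : {set E}, [/\ H \subset G,
    #|H| <= #|V| * \sum_(i < Delta.+1) #|B i| * (1 + lam ^ i) &
    forall c s t d, s \in S -> geodesic J (avoid G c) d s t ->
      reach J (avoid H c) d s t].
Proof.
move=> SB hit.
have MP (x : V * V * 'I_Delta.+1) := last_edges x.1.1 x.1.2 x.2.
have [M {}MP] := fin_all_exists MP.
pose H := \bigcup_t \bigcup_(i < Delta.+1) \bigcup_(r in B i)
  [set e in M (r, t, i)].
have inH r t (i : 'I_Delta.+1) e : r \in B i -> e \in M (r, t, i) -> e \in H.
  move=> rB eM; apply/bigcupP; exists t => //; apply/bigcupP; exists i => //.
  by apply/bigcupP; exists r => //; rewrite inE.
have HG : H \subset G.
  apply/bigcupsP => t _; apply/bigcupsP => i _; apply/bigcupsP => r _.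
  by apply/subsetP => e; rewrite inE; have [MG _ _] := MP (r, t, i); apply: MG.
exists H; split=> //.
  rewrite -sum_nat_const; apply: leq_trans (card_bigcup_le _ _) _.
  apply: leq_sum => t _; apply: leq_trans (card_bigcup_le _ _) _.
  apply: leq_sum => i _; apply: leq_trans (card_bigcup_le _ _) _.
  rewrite -sum_nat_const; apply: leq_sum => r _.
  have [_ szM _] := MP (r, t, i); apply: leq_trans szM.
  by rewrite cardsE card_size.
move=> c s t d sS; elim: d t => [|d IH] t gd.
  by case: gd => /reach0-> _; apply/reach0.
have [i iD fr] := exists_free_band c t.
have [r [j [rB jL jd w1 w2]]] : exists r j, [/\ r \in B i, 0 < j <= lam ^ i.+1,
    j <= d.+1, reach J (avoid G c) (d.+1 - j) s r & reach J (avoid G c) j r t].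
  (* If the path is shorter than the suffix length, the source [s] itself serves as [r], since [S]
     is contained in [B i]. *)
  have [dL|Ld] := ltnP d.+1 (lam ^ i.+1); last exact: hit gd Ld.
  exists s, d.+1; split=> //; first exact: (subsetP (SB i)).
  - by lia.
  - by rewrite subnn; apply/reach0.
  - by case: gd.
have gd' : geodesic J (avoid G c) (d.+1 - j + j) s t by rewrite subnK.
have [_ gj] := geodesic_split gd' w1 w2.
case: j => [|j] in jL jd w1 w2 gj gd' *; first by lia.
have [_ _ /(_ c j fr gj)[|e [u [eM ec Je wu]]]] := MP (r, t, Ordinal iD).
  by case/andP: jL.
have wsu : reach J (avoid G c) d s u.
  rewrite (_ : d = d.+1 - j.+1 + j); last lia.
  by apply/reachD; exists r.
(* The tail [u] of the stored edge is at distance [d] from [s], so the induction hypothesis applies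
   to it as a target. *)
have gdu : geodesic J (avoid G c) d s u.
  have eG : e \in avoid G c.
    by rewrite inE ec; have [MG _ _] := MP (r, t, Ordinal iD); rewrite MG.
  have gd1 : geodesic J (avoid G c) (d + 1) s t by rewrite addn1.
  by have [] := geodesic_split gd1 wsu; first by apply/reach1; exists e.
rewrite -addn1; apply/reachD; exists u; first exact: IH.
by apply/reach1; exists e => //; rewrite inE ec (inH r t (Ordinal iD)).
Qed.

End ColorFaultWalks.

(** From [ln (1 + x) <= x] at [x = - 1/2]. It lets [ln n] absorb additive constants when
    [n >= 2]. *)
Lemma ln2_ge_half (R : realType) : (2^-1 <= ln 2 :> R)%R.
Proof.
have := @le_ln1Dx R (- 2^-1)%R.
have -> : (1 + - 2^-1 = 2^-1 :> R)%R by field.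
by rewrite lnV ?posrE // => /(_ _); lra.
Qed.

(** * Size bounds for the sourcewise and pairwise preservers *)

Section PreserverSize.
Variables (R : realType) (V E : finType) (K : eqType).
Variables (G : {set E}) (col : E -> K).
Implicit Types (J : E -> rel V) (s t z : V) (c : K) (F : {set E}).

(** All shortest paths are taken together, so the set depends on no choice of a path and the sets to
    hit are indexed by [F], [s] and [t]. *)
Definition suffix_set J F L s t : {set V} :=
  [set z | `[< exists a b, [/\ 0 < b <= L, geodesic J F (a + b) s t,
                                reach J F a s z & reach J F b z t] >]].

(** Vertices chosen at distances 1 to [L] from [t] differ, because their distances to [t] do. *)
Lemma card_suffix_set J F L s t d :
  geodesic J F d s t -> L <= d -> L <= #|suffix_set J F L s t|.
Proof.
move=> gd Ld.
have hz (j : 'I_L) : exists z, reach J F (d - j.+1) s z /\ reach J F j.+1 z t.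
  have jd : d - j.+1 + j.+1 = d by have := ltn_ord j; lia.
  by move: (gd) => [] + _; rewrite -{1}jd => /reachD[z ? ?]; exists z.
have [f fP] := fin_all_exists hz.
have gf (j : 'I_L) : geodesic J F j.+1 (f j) t.
  have jd : d - j.+1 + j.+1 = d by have := ltn_ord j; lia.
  have [w1 w2] := fP j; move: gd; rewrite -{1}jd => gd'.
  by have [] := geodesic_split gd' w1 w2.
have finj : injective f.
  move=> i j fij; apply/val_inj; have := gf i; rewrite fij => gi.
  by have [] := geodesic_uniq gi (gf j).
rewrite -{1}(card_ord L) -(card_codom finj).
apply/subset_leq_card/subsetP => _ /codomP[j ->]; rewrite inE; apply/asboolP.
have [w1 w2] := fP j; exists (d - j.+1), j.+1; split=> //; first exact: ltn_ord.
by rewrite subnK // (leq_trans (ltn_ord j)).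
Qed.

Local Open Scope ring_scope.
Local Notation n := (#|V|%:R : R).

Lemma exists_hits_suffixes J L :
  (0 < L)%N -> (1 < #|V|)%N -> (#|G| <= #|V| ^ 2)%N ->
  exists2 B : {set V}, hits_suffixes J G col B L &
    #|B|%:R <= n / L%:R * (7 * ln n).
Proof.
move=> L0 V1 GV.
(* [K] may be infinite, so faults are indexed by an edge of the failing color, with [None] for
   colors absent from [G]. This gives at most [n^2 * (n^2 + 1) <= n^5] sets, and
   [5 * ln n + 1 <= 7 * ln n]. *)
pose W0 (x : V * V * option {e | e \in G}) := suffix_set J
  (if x.2 is Some e then avoid col G (col (val e)) else G) L x.1.1 x.1.2.
pose W : {set {set V}} := [set A in W0 @: setT | (L <= #|A|)%N].
have [|B hB cB] := @small_hitting_set V R W L L0.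
  by move=> A; rewrite inE => /andP[].
exists B.
  move=> c s t d gd Ld.
  have [o oc] : exists o : option {e | e \in G},
      (if o is Some e then avoid col G (col (val e)) else G) = avoid col G c.
    have [[e [eG ec]]|noe] := pselect (exists e, e \in G /\ col e = c).
      by exists (Some (exist _ e eG)); rewrite /= ec.
    exists None; apply/setP => e; rewrite inE; case eG: (e \in G) => //=.
    by apply/esym/eqP => ec; apply: noe; exists e.
  have [|r] := hB (W0 (s, t, o)).
    by rewrite inE imset_f //= /W0 /= oc; exact: card_suffix_set gd Ld.
  rewrite inE /W0 /= oc => /asboolP[a [b [bL gab wa wb]]] rB.
  have dab := geodesic_uniq gd gab; exists r, b; split=> //.
    by rewrite dab leq_addl.
  by rewrite dab addnK.
apply: (le_trans cB); rewrite ler_wpM2l ?divr_ge0 //.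
have n2 : 2 <= n by rewrite ler_nat.
have n0 : 0 < n by lra.
have lnn : 2^-1 <= ln n.
  by rewrite (le_trans (ln2_ge_half R)) // ler_ln ?posrE //; lra.
have WV : (#|W| <= #|V| ^ 5)%N.
  apply: (@leq_trans #|W0 @: setT|).
    by apply/subset_leq_card/subsetP => A; rewrite inE => /andP[].
  apply: (leq_trans (leq_imset_card _ _)).
  rewrite cardsT !card_prod card_option card_sig (expnD _ 2 3) -mulnn leq_mul //.
  have -> : #|[pred e | e \in G]| = #|G| by apply: eq_card.
  by rewrite (leq_ltn_trans GV) // ltn_exp2l.
have [->|W_gt0] := posnP #|W|; first by rewrite ln0 //; lra.
have : ln #|W|%:R <= 5 * ln n.
  rewrite mulr_natl -lnXn // ler_ln ?posrE ?exprn_gt0 ?ltr0n ?(ltnW V1) //.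
  by rewrite -natrX ler_nat.
by move=> ?; lra.
Qed.

Variables (Delta lam : nat).
Hypothesis class_le : forall c, (#|[set e in G | col e == c]| <= Delta)%N.
Hypothesis lam_gt0 : (0 < lam)%N.
Hypothesis Delta_gt0 : (0 < Delta)%N.
Hypothesis V_gt1 : (1 < #|V|)%N.
Hypothesis G_le : (#|G| <= #|V| ^ 2)%N.

(** Since [lam ^ i.+1 <= lam ^ Delta.+1], [S] obeys the size bound of each hitting set [B0 i]. Their
    union costs 14, the factor [1 + lam ^ i <= 2 * lam ^ i] makes it 28, and [Delta.+1 <= 2 * Delta]
    makes it 56. *)
Lemma sourcewise_preserver_bound J (S : {set V}) :
  (forall e x y x' y', J e x y -> J e x' y' ->
    (x' = x /\ y' = y) \/ (x' = y /\ y' = x)) ->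
  #|S|%:R <= n / (lam ^ Delta.+1)%:R * (7 * ln n) ->
  exists H : {set E}, [/\ H \subset G,
    #|H|%:R <= 56 * (n ^+ 2 / lam%:R * Delta%:R * ln n) &
    forall c s t d, s \in S -> geodesic J (avoid col G c) d s t ->
      reach J (avoid col H c) d s t].
Proof.
move=> J2 cS.
have hB i : exists B : {set V}, hits_suffixes J G col B (lam ^ i.+1) /\
    #|B|%:R <= n / (lam ^ i.+1)%:R * (7 * ln n).
  have [|B] := @exists_hits_suffixes J (lam ^ i.+1) _ V_gt1 G_le; last by exists B.
  by rewrite expn_gt0 lam_gt0.
have [B0 B0P] := boolp.choice hB.
have [|i|H [HG cH rH]] :=
    @sourcewise_preserver _ _ _ J G col Delta lam J2 class_le lam_gt0 S
      (fun i => S :|: B0 i).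
- by move=> i; exact: subsetUl.
- move=> c s t d gd Ld; have [hB0 _] := B0P i.
  have [r [j [rB jL jd w1 w2]]] := hB0 c s t d gd Ld.
  by exists r, j; split=> //; rewrite inE rB orbT.
exists H; split=> //.
have lnn : 0 <= ln n by rewrite ln_ge0 // ler1n ltnW.
have l1 : 1 <= lam%:R :> R by rewrite ler1n.
have l0 : 0 < lam%:R :> R by rewrite ltr0n.
have term (i : 'I_Delta.+1) :
    (#|S :|: B0 i| * (1 + lam ^ i))%:R <= 28 * (n / lam%:R * ln n).
  have [_ cB] := B0P i.
  have li1 : 1 <= lam%:R ^+ i :> R by rewrite exprn_ege1.
  have cS' : #|S|%:R <= n / (lam ^ i.+1)%:R * (7 * ln n).
    apply: (le_trans cS); rewrite ler_wpM2r ?mulr_ge0 // ler_wpM2l // lef_pV2.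
    - by rewrite ler_nat leq_pexp2l.
    - by rewrite posrE ltr0n expn_gt0 lam_gt0.
    - by rewrite posrE ltr0n expn_gt0 lam_gt0.
  have cU : #|S :|: B0 i|%:R <= 14 * (n / (lam ^ i.+1)%:R * ln n).
    apply: (@le_trans _ _ (#|S|%:R + #|B0 i|%:R)).
      by rewrite -natrD ler_nat leq_card_setU.
    by move: cS' cB; lra.
  rewrite natrM natrD natrX; apply: (@le_trans _ _
    (14 * (n / (lam ^ i.+1)%:R * ln n) * (2 * lam%:R ^+ i))).
    by apply: ler_pM => //; lra.
  rewrite le_eqVlt; apply/orP; left; apply/eqP; rewrite natrX exprS; field.
  by rewrite expf_neq0 gt_eqF.
apply: (@le_trans _ _ (n * (Delta.+1%:R * (28 * (n / lam%:R * ln n))))).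
  apply: (@le_trans _ _ (#|V| * \sum_(i < Delta.+1) #|S :|: B0 i| * (1 + lam ^ i))%:R).
    by rewrite ler_nat.
  rewrite natrM ler_wpM2l // natr_sum mulr_natl -[X in _ *+ X]card_ord -sumr_const.
  by apply: ler_sum => i _; exact: term.
have D2 : Delta.+1%:R <= 2 * Delta%:R :> R by rewrite -natrM ler_nat; lia.
have q0 : 0 <= n ^+ 2 / lam%:R * ln n by rewrite mulr_ge0 // divr_ge0 // exprn_ge0.
have -> : n * (Delta.+1%:R * (28 * (n / lam%:R * ln n))) =
    Delta.+1%:R * (28 * (n ^+ 2 / lam%:R * ln n)) by rewrite expr2; ring.
apply: (@le_trans _ _ (2 * Delta%:R * (28 * (n ^+ 2 / lam%:R * ln n)))).
  by rewrite ler_wpM2r // mulr_ge0.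
by rewrite le_eqVlt; apply/orP; left; apply/eqP; ring.
Qed.

(** A long replacement path is cut at a vertex [r] of [S]: [H1] preserves the part from [r] to [t],
    and [H2], built in the reversed graph, the part from [s] to [r]. Short paths lie in [H3]. The
    constant 112 is 56 for each of [H1] and [H2]. *)
Lemma pairwise_preserver_bound J (P : {set V * V}) :
  (forall e x y x' y', J e x y -> J e x' y' ->
    (x' = x /\ y' = y) \/ (x' = y /\ y' = x)) ->
  exists H : {set E}, [/\ H \subset G,
    #|H|%:R <= 112 * (n ^+ 2 / lam%:R * Delta%:R * ln n)
               + 2 * (#|P| * lam ^ (2 * Delta + 2))%:R &
    forall c s t d, (s, t) \in P -> geodesic J (avoid col G c) d s t ->
      reach J (avoid col H c) d s t].
Proof.
move=> J2; pose l := (lam ^ Delta.+1)%N.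
have l0 : (0 < l)%N by rewrite expn_gt0 lam_gt0.
have [S hS cS] := @exists_hits_suffixes J l l0 V_gt1 G_le.
pose Jr e x y := J e y x.
have Jr2 e x y x' y' : Jr e x y -> Jr e x' y' ->
    (x' = x /\ y' = y) \/ (x' = y /\ y' = x).
  by move=> h h'; case: (J2 _ _ _ _ _ h h') => -[]; tauto.
have [H1 [H1G cH1 rH1]] := sourcewise_preserver_bound J2 cS.
(* Only the size of [S] matters here, so the same [S] works as source set in the reversed graph. *)
have [H2 [H2G cH2 rH2]] := sourcewise_preserver_bound Jr2 cS.
have MP (x : V * V) := short_replacements J G col x.1 x.2 l.
have [M {}MP] := fin_all_exists MP.
pose H3 := \bigcup_(x in P) [set e in M x].
have H3G : H3 \subset G.
  apply/bigcupsP => x _; apply/subsetP => e; rewrite inE.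
  by have [MG _ _] := MP x; exact: MG.
have cH3 : (#|H3| <= 2 * (#|P| * lam ^ (2 * Delta + 2)))%N.
  apply: leq_trans (card_bigcup_le _ _) _.
  rewrite mulnCA -sum_nat_const; apply: leq_sum => x _.
  have [_ szM _] := MP x; rewrite cardsE.
  apply: leq_trans (card_size _) _; apply: leq_trans szM _.
  have -> : (lam ^ (2 * Delta + 2) = l * l)%N by rewrite -expnD; congr expn; lia.
  by rewrite mul2n -addnn leq_add2r leq_pmulr.
exists (H1 :|: H2 :|: H3); split.
- by rewrite !subUset H1G H2G.
- apply: (@le_trans _ _ (#|H1|%:R + #|H2|%:R + #|H3|%:R)).
    rewrite -!natrD ler_nat; apply: leq_trans (leq_card_setU _ _) _.
    by rewrite leq_add2r leq_card_setU.
  move: cH3; rewrite -(ler_nat R) natrM => cH3.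
  by move: cH1 cH2 cH3; lra.
move=> c s t d stP gd; have [dl|ld] := leqP d l.
  have [_ _ /(_ c d gd dl)[es [sz sM sG w]]] := MP (s, t).
  exists es; split=> // e e_es; have := sG e e_es; rewrite !inE => /andP[_ ->].
  rewrite andbT; apply/orP; right; apply/bigcupP; exists (s, t) => //.
  by rewrite inE sM.
have [r [j [rS jl jd w1 w2]]] := hS c s t d gd (ltnW ld).
have gd' : geodesic J (avoid col G c) (d - j + j) s t by rewrite subnK.
have [g1 g2] := geodesic_split gd' w1 w2.
rewrite -(subnK jd); apply/reachD; exists r.
  have /reach_rev := rH2 c r s (d - j)%N rS (proj2 (geodesic_rev J _ _ _ _) g1).
  by apply: sub_reach; apply: avoidS; rewrite -setUA setUCA subsetUl.
have := rH1 c r t j rS g2.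
by apply: sub_reach; apply: avoidS; rewrite -setUA subsetUl.
Qed.

End PreserverSize.

(** * Transfer to walks and distances in colored graphs *)

Lemma reachS (V E : finType) (J : E -> rel V) F k x y :
  reach J F k.+1 x y <->
  exists e z, [/\ e \in F, J e x z & reach J F k z y].
Proof.
rewrite -add1n; split=> [/reachD[z /reach1[e eF Je] w]|[e [z [eF Je w]]]].
  by exists e, z.
by apply/reachD; exists z => //; apply/reach1; exists e.
Qed.

Lemma reach_walk (o : orientation) (V : finType) (F : {set edge o V}) k x y :
  reach (@joins o V) F k x y <-> walk (adj F) x y k.
Proof.
elim: k x => [|k IH] x.
  split=> [/reach0->|/fintype.existsP[p]]; first by apply/fintype.existsP; exists [tuple] => /=.
  by rewrite tuple0 /= => /eqP->; apply/reach0.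
split=> [/reachS[e [z [eF Je /IH/fintype.existsP[p /andP[pp pl]]]]]|/fintype.existsP[p]].
  apply/fintype.existsP; exists [tuple of z :: p]; rewrite /= pp pl !andbT.
  by apply/fintype.existsP; exists e; rewrite eF.
case/tupleP: p => z p /= /andP[/andP[/fintype.existsP[e /andP[eF Je]] pp] pl].
apply/reachS; exists e, z; split=> //; apply/IH/fintype.existsP.
by exists p; rewrite pp.
Qed.

Lemma eq_dist (V : finType) (r r' : rel V) x y :
  (forall k, walk r' x y k -> walk r x y k) ->
  (forall d, walk r x y d -> (forall j, walk r x y j -> d <= j) ->
     walk r' x y d) ->
  dist r' x y = dist r x y.
Proof.
move=> sub_r short; rewrite /dist.
case: pselect => [ex'|no']; case: pselect => [ex|no] //.
- congr Some; case: ex_minnP => m' w' min'; case: ex_minnP => m w minm.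
  apply/eqP; rewrite eqn_leq minm ?sub_r // andbT min' //; exact: short.
- by case: no; case: ex' => k /sub_r; exists k.
- case: no'; case: (ex_minnP ex) => m w minm; exists m; exact: short.
Qed.

Lemma joins_uniq (o : orientation) (V : finType) (e : edge o V) x y x' y' :
  joins e x y -> joins e x' y' ->
  (x' = x /\ y' = y) \/ (x' = y /\ y' = x).
Proof.
case: o e => e /= /eqP-> /eqP; first by case=> -> ->; left.
move=> exy.
have x'_in : x' \in [set x; y] by rewrite exy set21.
have y'_in : y' \in [set x; y] by rewrite exy set22.
have x_in : x \in [set x'; y'] by rewrite -exy set21.
have y_in : y \in [set x'; y'] by rewrite -exy set22.
move: x'_in y'_in x_in y_in; rewrite !inE.
by do 4![case/orP => /eqP ?]; subst; auto.
Qed.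

Section ColoredGraph.
Variables (o : orientation) (V : finType) (K : eqType) (G : colored_graph o V K).

Lemma card_edges_le : #|edges G| <= #|V| ^ 2.
Proof.
case: o G => G'; first by rewrite -mulnn -card_prod max_card.
apply: (@leq_trans #|[set [set x.1; x.2] | x in [set: V * V]]|).
  apply/subset_leq_card/subsetP => e /edgesP /= /cards2P[x [y [_ ->]]].
  by apply/imsetP; exists (x, y); rewrite ?inE.
by apply: leq_trans (leq_imset_card _ _) _; rewrite cardsT card_prod mulnn.
Qed.

Lemma edges_eq0 : #|V| <= 1 -> edges G = set0.
Proof.
move=> V1; apply/setP => e; rewrite inE; apply/negP => /edgesP.
case: o e => e /=; last by move/eqP => e2; have := max_card e; rewrite e2; lia.
by rewrite (fintype_le1P V1 e.1 e.2) eqxx.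
Qed.

(* [avoid (color G) F c] is convertible to [delete_color G F c]. *)
Lemma cft1_preserver_geodesic (P : {set V * V}) (H : {set edge o V}) :
  H \subset edges G ->
  (forall c s t d, (s, t) \in P ->
     geodesic (@joins o V) (avoid (color G) (edges G) c) d s t ->
     reach (@joins o V) (avoid (color G) H c) d s t) ->
  cft1_preserver G P H.
Proof.
move=> HG short; split=> // c s t stP; apply: eq_dist => [k /reach_walk w|d wd mind].
  by apply/reach_walk; apply: sub_reach w; exact: avoidS.
apply/reach_walk; apply: short stP _; split=> [|j w].
  by apply/reach_walk.
by apply: mind; apply/reach_walk.
Qed.

End ColoredGraph.

(** * Choice of [lam] and the final bound *)

Lemma exists_max_base (p N q : nat) : 0 < q -> 0 < p <= N ->
  exists lam, [/\ 0 < lam, p * lam ^ q <= N & N < p * lam.+1 ^ q].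
Proof.
move=> q0 /andP[p0 pN].
have ex1 : exists l, p * l ^ q <= N by exists 1; rewrite exp1n muln1.
have bnd l : p * l ^ q <= N -> l <= N.
  move=> h; apply: leq_trans h; case: l => // l.
  apply: (@leq_trans (l.+1 ^ q)); last by rewrite leq_pmull.
  by rewrite -{1}[l.+1]expn1 leq_pexp2l.
case: (ex_maxnP ex1 bnd) => lam le_lam max_lam; exists lam; split=> //.
  by apply: max_lam; rewrite exp1n muln1.
by rewrite ltnNge; apply/negP => /max_lam; rewrite ltnn.
Qed.

Local Open Scope ring_scope.

(** Write [n^2] as [n^(2 - 2/q) * n^(2/q)]; then [n^(2/q) <= (lam + 1) * p^(1/q) <= 2 * lam *
    p^(1/q)]. *)
Lemma max_base_bound (R : realType) (n p lam q : nat) :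
  (0 < n)%N -> (0 < lam)%N -> (0 < q)%N -> (n ^ 2 < p * lam.+1 ^ q)%N ->
  n%:R ^+ 2 / lam%:R <= 2 * (n%:R `^ (2 - 2 / q%:R) * p%:R `^ (1 / q%:R)) :> R.
Proof.
move=> n0 l0 q0 lt_n.
have nR : 0 < n%:R :> R by rewrite ltr0n.
have lR : 0 < lam%:R :> R by rewrite ltr0n.
have qR : 0 < q%:R :> R by rewrite ltr0n.
rewrite ler_pdivrMr //.
have -> : n%:R ^+ 2 = n%:R `^ (2 - 2 / q%:R) * n%:R `^ (2 / q%:R) :> R.
  rewrite -powRD; last by rewrite (gt_eqF nR) implybT.
  by rewrite subrK -powR_mulrn // ltW.
rewrite mulrCA -!mulrA ler_wpM2l ?powR_ge0 //.
have -> : n%:R `^ (2 / q%:R) = (n%:R ^+ 2) `^ (1 / q%:R) :> R.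
  by rewrite -powR_mulrn ?ltW // -powRrM mul1r.
apply: (@le_trans _ _ (((2 * lam%:R) ^+ q * p%:R) `^ (1 / q%:R))).
  apply: ge0_ler_powR; rewrite ?nnegrE ?divr_ge0 ?mulr_ge0 ?exprn_ge0 ?mulr_ge0 //.
  rewrite -natrM -!natrX -natrM ler_nat (leq_trans (ltnW lt_n)) // mulnC leq_mul //.
  by rewrite leq_exp2r //; lia.
rewrite powRM ?exprn_ge0 ?mulr_ge0 // -powR_mulrn ?mulr_ge0 // -powRrM.
rewrite mulrC mulrA mul1r divff ?gt_eqF // powRr1 ?mulr_ge0 //.
by rewrite le_eqVlt; apply/orP; left; apply/eqP; ring.
Qed.

Theorem theorem1p3 (R : realType) :
  exists C : R, 0 < C /\
  forall (Delta : nat) (o : orientation) (V : finType) (K : eqType)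
    (G : colored_graph o V K),
    (1 <= Delta)%N ->
    (forall c : K, (#|color_class G c| <= Delta)%N) ->
    forall P : {set V * V},
    exists H : {set edge o V},
      cft1_preserver G P H /\
      (#|H|%:R : R) <=
        C * (#|V|%:R `^ (2 - 2 / (2 * Delta%:R + 3))
             * #|P|%:R `^ (1 / (2 * Delta%:R + 3))
             * Delta%:R * ln #|V|%:R).
Proof.
(* The bulk gives [112 * 2 = 224]. The short paths cost at most [2 * (2 * X)], and
   [X <= 2 * (X * Delta * ln n)] turns this into the remaining 8. *)
exists 232; split=> // Delta o V K G D1 class_le P.
have rhs0 : (0 : R) <= 232 * (#|V|%:R `^ (2 - 2 / (2 * Delta%:R + 3))
    * #|P|%:R `^ (1 / (2 * Delta%:R + 3)) * Delta%:R * ln #|V|%:R).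
  have [->|V0] := posnP #|V|; first by rewrite [ln _]ln0 // mulr0 mulr0.
  by rewrite !mulr_ge0 ?powR_ge0 ?ln_ge0 ?ler1n.
have [V1|V1] := leqP #|V| 1.
  exists set0; rewrite cards0; split=> //.
  by apply: cft1_preserver_geodesic; rewrite ?sub0set // (edges_eq0 G V1) => c s t d _ [].
have [P0|P_neq0] := eqVneq P set0.
  by exists set0; rewrite cards0; split=> //; split=> [|c s t]; rewrite ?sub0set // P0 inE.
have P_gt0 : (0 < #|P|)%N by rewrite card_gt0.
have PV : (#|P| <= #|V| ^ 2)%N by rewrite -mulnn -card_prod max_card.
(* The exponent balances the cost [#|P| * lam ^ (2 * Delta + 2)] of the short paths against
   [n^2 / lam]. *)
have [||lam [l0 le_lam lt_lam]] := @exists_max_base #|P| (#|V| ^ 2) (2 * Delta + 3) _ _.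
- by lia.
- by rewrite P_gt0.
have [H [HG cH rH]] := @pairwise_preserver_bound R V _ K (edges G) (color G) Delta lam
  class_le l0 D1 V1 (card_edges_le G) (@joins o V) P (@joins_uniq o V).
exists H; split; first exact: cft1_preserver_geodesic.
have := @max_base_bound R #|V| #|P| lam (2 * Delta + 3) (ltnW V1) l0 _ lt_lam.
rewrite natrD natrM; set X := _ `^ _ * _ `^ _ => /(_ _) X_ge.
have {}X_ge : #|V|%:R ^+ 2 / lam%:R <= 2 * X by apply: X_ge; lia.
apply: (le_trans cH).
have lR : 0 < lam%:R :> R by rewrite ltr0n.
have short_le : (#|P| * lam ^ (2 * Delta + 2))%:R <= #|V|%:R ^+ 2 / lam%:R :> R.
  rewrite ler_pdivlMr // -natrM -natrX ler_nat -mulnA -expnSr.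
  by rewrite -addnS.
have X0 : 0 <= X by rewrite mulr_ge0 ?powR_ge0.
have V2 : 2 <= #|V|%:R :> R by rewrite ler_nat.
have lnV : 2^-1 <= ln #|V|%:R :> R.
  by rewrite (le_trans (ln2_ge_half R)) // ler_ln ?posrE //; lra.
have DR : 1 <= Delta%:R :> R by rewrite ler1n.
have Dln : 2^-1 <= Delta%:R * ln #|V|%:R :> R by nra.
have bulk : #|V|%:R ^+ 2 / lam%:R * Delta%:R * ln #|V|%:R
    <= 2 * X * Delta%:R * ln #|V|%:R.
  by apply: ler_wpM2r; [lra | apply: ler_wpM2r].
have X_le : X <= 2 * (X * Delta%:R * ln #|V|%:R).
  by rewrite -mulrA; nra.
lra.
Qed.
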